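(* Let $G^{(1)},G^{(2)}\in\mathbb{R}^{N\times N}$ be symmetric matrices with zero diagonals (undirected layers) and let $\kappa\in[0,1)$. If $$|\lambda_{\min}(G^{(2)})|\geq\frac{1}{1-\kappa}\bigl(1+\kappa\lambda_{\max}(G^{(1)})\bigr),$$ then the multiplex network game with layers $G^{(1)},G^{(2)}$ and parameter $\kappa$ is not guaranteed to have a unique Nash equilibrium; that is, there exist benefit functions and unit costs for which the game either has no Nash equilibrium or has multiple Nash equilibria.
   Context: $\lambda_{\min}$ and $\lambda_{\max}$ denote the smallest and largest eigenvalues of a symmetric matrix. Multiplex network game: there are $N$ agents; agent $i$ chooses an effort $x_i\in\mathbb{R}_{\geq 0}$. The two layers are given by real $N\times N$ matrices $G^{(1)}=(g^{(1)}_{ij})$ and $G^{(2)}=(g^{(2)}_{ij})$ with zero diagonals (entries of arbitrary sign), and $\kappa\in[0,1]$. Agent $i$'s utility is $$u_i(\mathbf{x})=b_i\Bigl(x_i+\kappa\sum_{j=1}^N g^{(1)}_{ij}x_j+(1-\kappa)\sum_{j=1}^N g^{(2)}_{ij}x_j\Bigr)-c_ix_i,$$ where the benefit function $b_i:\mathbb{R}\to\mathbb{R}$ is twice differentiable, strictly increasing and strictly concave, and the unit cost is $c_i>0$; it is assumed that there is a (necessarily unique) $q_i\in\mathbb{R}$ with $b_i'(q_i)=c_i$. Write $G^{\parallel}:=\kappa G^{(1)}+(1-\kappa)G^{(2)}$. A (pure) Nash equilibrium is a vector $\mathbf{x}^*\in\mathbb{R}^N_{\geq 0}$ such that each $x_i^*$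 maximizes $u_i$ over $x_i\ge 0$ given the others; equivalently, $x_i^*=\max\{0,\,q_i-(G^{\parallel}\mathbf{x}^* )_i\}$ for all $i$. *)

(* Defs.v *)
From mathcomp Require Import all_boot all_order all_algebra.
From mathcomp Require Import all_classical all_reals all_analysis.

Set Implicit Arguments.
Unset Strict Implicit.
Unset Printing Implicit Defensive.

Import Order.TTheory GRing.Theory Num.Theory.
Import numFieldNormedType.Exports.

Local Open Scope classical_set_scope.
Local Open Scope ring_scope.

(* The set of eigenvalues of a real symmetric matrix of positive size is
   finite and nonempty, so that its infimum and supremum are its least and
   greatest elements. *)
Definition lambda_min (R : realType) (N : nat) (G : 'M[R]_N) : R :=
  inf [set l | eigenvalue G l].

Definition lambda_max (R : realType) (N : nat) (G : 'M[R]_N) : R :=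
  sup [set l | eigenvalue G l].

Definition zero_diagonal (R : realType) (N : nat) (G : 'M[R]_N) : Prop :=
  forall i, G i i = 0.

Definition twice_differentiable (R : realType) (b : R -> R) : Prop :=
  (forall t, derivable b t 1) /\ (forall t, derivable (derive1 b) t 1).

Definition strictly_increasing (R : realType) (b : R -> R) : Prop :=
  {homo b : s t / s < t}.

Definition strictly_concave (R : realType) (b : R -> R) : Prop :=
  forall s t p : R, s != t -> 0 < p < 1 ->
    p * b s + (1 - p) * b t < b (p * s + (1 - p) * t).

Definition benefit_function (R : realType) (b : R -> R) : Prop :=
  [/\ twice_differentiable b, strictly_increasing b & strictly_concave b].

Definition admissible_benefits_costs (R : realType) (N : nat)
    (b : 'I_N -> R -> R) (c : 'I_N -> R) : Prop :=
  forall i, [/\ benefit_function (b i), 0 < c i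
    & exists q : R, derive1 (b i) q = c i].

Definition utility (R : realType) (N : nat) (G1 G2 : 'M[R]_N) (kappa : R)
    (b : 'I_N -> R -> R) (c : 'I_N -> R) (i : 'I_N) (x : 'cV[R]_N) : R :=
  b i (x i 0 + kappa * \sum_(j < N) G1 i j * x j 0
             + (1 - kappa) * \sum_(j < N) G2 i j * x j 0)
  - c i * x i 0.

Definition deviate (R : realType) (N : nat) (x : 'cV[R]_N) (i : 'I_N) (y : R)
  : 'cV[R]_N := \col_j (if j == i then y else x j 0).

Definition nash_equilibrium (R : realType) (N : nat) (G1 G2 : 'M[R]_N)
    (kappa : R) (b : 'I_N -> R -> R) (c : 'I_N -> R) (x : 'cV[R]_N) : Prop :=
  (forall i, 0 <= x i 0) /\
  (forall i (y : R), 0 <= y ->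
     utility G1 G2 kappa b c i (deviate x i y) <=
     utility G1 G2 kappa b c i x).

(* Main.v *)
(** Put [M = 1 + kappa G1 + (1 - kappa) G2]. Since [G2] has zero trace its least
    eigenvalue is nonpositive, so on an eigenvector of it the bound makes the
    quadratic form of [M] nonpositive. A symmetric matrix that is not positive
    definite is not a P-matrix: some [v != 0] satisfies [v_i (M v)_i <= 0] for
    all [i]. With benefits [- exp (q_i - t)] and unit costs, an equilibrium is a
    solution of the linear complementarity problem [x >= 0], [M x - q >= 0],
    [x_i (M x - q)_i = 0]. For [q = M v^+ - (M v)^+ = M v^- - (M v)^-] the positive
    part [v^+] and the negative part [v^-] are two distinct solutions. *)

Require Import Defs.
From mathcomp Require Import all_boot all_order all_algebra.
From mathcomp Require Import all_classical all_reals all_analysis.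
From mathcomp Require Import ring lra.

Import Order.TTheory GRing.Theory Num.Theory.
Import numFieldNormedType.Exports.

Local Open Scope ring_scope.

(** * Quadratic forms of symmetric matrices *)

(** Vectors are rows because [eigenvalue] refers to left eigenvectors. At [1%:M] the form is the
    squared Euclidean norm on the diagonal. *)
Definition bform {R : comNzRingType} {n : nat} (A : 'M[R]_n)
    (u v : 'rV[R]_n) : R :=
  (u *m A *m v^T) 0 0.

Lemma bformDl {R : comNzRingType} {n} (A : 'M[R]_n) u v w :
  bform A (u + v) w = bform A u w + bform A v w.
Proof. by rewrite /bform !mulmxDl mxE. Qed.

Lemma bformDr {R : comNzRingType} {n} (A : 'M[R]_n) u v w :
  bform A u (v + w) = bform A u v + bform A u w.
Proof. by rewrite /bform linearD mulmxDr mxE. Qed.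

Lemma bformZl {R : comNzRingType} {n} (A : 'M[R]_n) a u v :
  bform A (a *: u) v = a * bform A u v.
Proof. by rewrite /bform -!scalemxAl mxE. Qed.

Lemma bformZr {R : comNzRingType} {n} (A : 'M[R]_n) a u v :
  bform A u (a *: v) = a * bform A u v.
Proof. by rewrite /bform linearZ -scalemxAr mxE. Qed.

Lemma bform_sum {R : comNzRingType} {n} (A : 'M[R]_n) u v :
  bform A u v = \sum_i (u *m A) 0 i * v 0 i.
Proof. by rewrite /bform mxE; apply: eq_bigr => i _; rewrite [v^T _ _]mxE. Qed.

Lemma bformC {R : comNzRingType} {n} (A : 'M[R]_n) u v :
  A^T = A -> bform A u v = bform A v u.
Proof.
move=> As; have -> : bform A v u = (v *m A *m u^T)^T 0 0 by rewrite [RHS]mxE.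
by rewrite !trmx_mul trmxK As mulmxA.
Qed.

Lemma bform_addmx {R : comNzRingType} {n} (A B : 'M[R]_n) u v :
  bform (A + B) u v = bform A u v + bform B u v.
Proof. by rewrite /bform mulmxDr mulmxDl mxE. Qed.

Lemma bform_scalemx {R : comNzRingType} {n} a (A : 'M[R]_n) u v :
  bform (a *: A) u v = a * bform A u v.
Proof. by rewrite /bform -scalemxAr -scalemxAl mxE. Qed.

Lemma bform_eigenvector {R : comNzRingType} {n} (A : 'M[R]_n) l v :
  v *m A = l *: v -> bform A v v = l * bform 1%:M v v.
Proof. by move=> vA; rewrite /bform vA mulmx1 -scalemxAl mxE. Qed.

Lemma bform1_ge0 {R : realFieldType} {n} (u : 'rV[R]_n) : 0 <= bform 1%:M u u.
Proof.
by rewrite bform_sum mulmx1; apply: sumr_ge0 => i _; rewrite -expr2 sqr_ge0.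
Qed.

Lemma bform1_eq0 {R : realFieldType} {n} (u : 'rV[R]_n) :
  (bform 1%:M u u == 0) = (u == 0).
Proof.
rewrite bform_sum mulmx1 psumr_eq0; last by move=> i _; rewrite -expr2 sqr_ge0.
apply/allP/eqP => [u0|-> i _]; last by rewrite mxE mul0r eqxx.
by apply/rowP => i; have := u0 i (mem_index_enum i); rewrite mulf_eq0 orbb mxE => /eqP.
Qed.

(** With [w = v *m B], the form at [v + t w] is [2 t |w|^2 + t^2 b]. For small negative [t] the
    linear term dominates, so nonnegativity forces [w = 0]. *)
Lemma psd_isotropic_ker {R : realFieldType} {n} (B : 'M[R]_n) v :
  B^T = B -> (forall u, 0 <= bform B u u) -> bform B v v = 0 -> v *m B = 0.
Proof.
move=> Bs B_ge0 vBv0; set w := v *m B.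
have vBw : bform B v w = bform 1%:M w w by rewrite /bform mulmx1.
set s := bform 1%:M w w in vBw; set b := bform B w w.
have b1_gt0 : 0 < b + 1 by rewrite ltr_wpDl ?B_ge0.
(* The denominator [b + 1] in place of [b] avoids a separate case [b = 0]. *)
have := B_ge0 (v + (- s / (b + 1)) *: w).
rewrite bformDl !bformDr !bformZl !bformZr vBv0 (bformC B w v Bs) vBw -/b.
have -> : 0 + - s / (b + 1) * s +
    (- s / (b + 1) * s + - s / (b + 1) * (- s / (b + 1) * b)) =
    - (s ^+ 2 * (b + 2) / (b + 1) ^+ 2) by field; rewrite gt_eqF.
rewrite oppr_ge0 pmulr_lle0 ?invr_gt0 ?exprn_gt0// pmulr_lle0; last first.
  by rewrite ltr_wpDl ?B_ge0.
rewrite real_exprn_even_le0 ?num_real//= => s0.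
by apply/eqP; rewrite -bform1_eq0.
Qed.

(* On a minimal principal block where M is not positive definite, the minimiser
   of the quadratic form with one coordinate fixed to 1 has M v = 0 on the other
   coordinates of the block. *)
Lemma sign_reversed_vector {R : realFieldType} {n} (M : 'M[R]_n) (u : 'rV[R]_n) :
  M^T = M -> u != 0 -> bform M u u <= 0 ->
  exists2 v : 'rV[R]_n, v != 0 & forall i, (v *m M) 0 i * v 0 i <= 0.
Proof.
move=> Ms; pose supp_in (S : {set 'I_n}) (z : 'rV[R]_n) := forall k, k \notin S -> z 0 k = 0.
move=> u_neq0 uMu_le0.
(* Induction on the size of a set containing the support of [u] yields the minimal block. *)
have : exists S, supp_in S u by exists (finset.setTfor 'I_n) => k; rewrite inE.
case=> S; have [m] := ubnP #|S|.
elim: m => // m IH in S u u_neq0 uMu_le0 * => S_lem uS.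
have [i ui_neq0] : exists i, u 0 i != 0 by apply/rV0Pn.
have iS : i \in S by apply: contraNT ui_neq0 => /uS ->.
pose T := S :\ i.
have [[z [z_neq0 zT zMz_le0]]|T_pd] :=
    pselect (exists z : 'rV[R]_n, [/\ z != 0, supp_in T z & bform M z z <= 0]).
  by apply: (IH T z) => //; rewrite (cardsD1 i S) iS in S_lem.
have iT : i \notin T by rewrite setD11.
have T_psd z : supp_in T z -> 0 <= bform M z z.
  move=> zT; have [->|z0] := eqVneq z 0; first by rewrite /bform mul0mx mul0mx mxE.
  by rewrite leNgt; apply/negP => /ltW zMz; apply: T_pd; exists z.
(* The equation [v *m C = delta_mx 0 i] encodes both requirements on [v]: it agrees with the basis
   vector at [i] outside [T], and [v *m M] vanishes on [T]. A kernel vector of [C] would be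
   supported in [T] with zero form, against [T_pd]. *)
pose C := \matrix_(j, k) if k \in T then M j k else (j == k)%:R.
have mulC_in (z : 'rV[R]_n) k : k \in T -> (z *m C) 0 k = (z *m M) 0 k.
  by move=> kT; rewrite !mxE; apply: eq_bigr => j _; rewrite mxE kT.
have mulC_out (z : 'rV[R]_n) k : k \notin T -> (z *m C) 0 k = z 0 k.
  move=> kT; rewrite !mxE (bigD1 k)//= mxE (negPf kT) eqxx mulr1 big1 ?addr0// => j jk.
  by rewrite mxE (negPf kT) (negPf jk) mulr0.
have C_unit : C \in unitmx.
  rewrite -row_free_unit; apply: inj_row_free => z zC0.
  have zT : supp_in T z by move=> k kT; rewrite -mulC_out// zC0 mxE.
  apply/eqP/negPn/negP => z_neq0; apply: T_pd; exists z; split=> //.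
  rewrite bform_sum big1// => k _; have [kT|/zT ->] := boolP (k \in T); last by rewrite mulr0.
  by rewrite -mulC_in// zC0 mxE mul0r.
have [v vC] : exists v : 'rV[R]_n, v *m C = delta_mx 0 i.
  by exists (delta_mx 0 i *m invmx C); rewrite mulmxKV.
have v_out k : k \notin T -> v 0 k = (k == i)%:R by move=> kT; rewrite -mulC_out// vC mxE.
have vM_in k : k \in T -> (v *m M) 0 k = 0.
  by move=> kT; rewrite -mulC_in// vC mxE eqxx/=; case: eqP kT => //= ->; rewrite (negPf iT).
have vi : v 0 i = 1 by rewrite v_out// eqxx.
have vMv : bform M v v = (v *m M) 0 i.
  rewrite bform_sum (bigD1 i)//= vi mulr1 big1 ?addr0// => k ki.
  have [/vM_in ->|/v_out ->] := boolP (k \in T); first by rewrite mul0r.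
  by rewrite (negPf ki) mulr0.
(* The rescaled [u] splits as [v + w] with [w] supported in [T], hence [M]-orthogonal to [v]. The
   form at [v] is then that of the rescaled [u] minus the nonnegative form at [w]. *)
have vM_le0 : (v *m M) 0 i <= 0.
  pose w := (u 0 i)^-1 *: u - v.
  have wT : supp_in T w.
    move=> k kT; rewrite !mxE v_out//; have [->|ki] := eqVneq k i; first by rewrite mulVf ?subrr.
    rewrite mulr0n subr0 (uS k) ?mulr0//; by move: kT; rewrite in_setD1 ki.
  have vMw : bform M v w = 0.
    rewrite bform_sum big1// => k _; have [/vM_in ->|/wT ->] := boolP (k \in T).
      by rewrite mul0r.
    by rewrite mulr0.
  have : bform M (v + w) (v + w) <= 0.
    rewrite (_ : v + w = (u 0 i)^-1 *: u); last by rewrite addrC subrK.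
    by rewrite bformZl bformZr mulrA -expr2 mulr_ge0_le0 ?sqr_ge0.
  clearbody w; rewrite bformDl !bformDr (bformC M w v Ms) vMw vMv.
  by have := T_psd w wT; lra.
exists v; first by apply/rV0Pn; exists i; rewrite vi oner_eq0.
move=> k; have [/vM_in ->|/v_out ->] := boolP (k \in T); first by rewrite mul0r.
by have [->|] := eqVneq k i; rewrite ?mulr1 ?mulr0.
Qed.

(** * Extreme eigenvalues through the Rayleigh quotient *)

Lemma continuous_bform {R : realType} {n} (A : 'M[R]_n) :
  continuous (fun u : 'rV[R]_n => bform A u u).
Proof.
have -> : (fun u : 'rV[R]_n => bform A u u) =
    (fun u => \sum_i (\sum_j u 0 j * A j i) * u 0 i).
  by apply/funext => u; rewrite bform_sum; apply: eq_bigr => i _; rewrite mxE.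
apply: continuous_big => [|i _]; first exact: add_continuous.
move=> u; apply: continuousM; last exact: coord_continuous.
move: u; apply: continuous_big => [|j _]; first exact: add_continuous.
move=> u; apply: continuousM; [exact: coord_continuous|exact: cst_continuous].
Qed.

(** The form attains a minimum [mu] on the compact unit sphere. Then [A - mu] is positive
    semidefinite and the minimiser is isotropic for it, hence in its kernel. *)
Lemma rayleigh_min {R : realType} {n} (A : 'M[R]_n) : (0 < n)%N -> A^T = A ->
  exists (v : 'rV[R]_n) mu, [/\ v != 0, v *m A = mu *: v &
    forall u, mu * bform 1%:M u u <= bform A u u].
Proof.
move=> n_gt0 As.
pose S := [set u : 'rV[R]_n | bform 1%:M u u = 1]%classic.
have S_closed : closed S.
  apply: (@preimage_closed _ _ _ [set x : R | x = 1]); last exact: closed_eq.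
  by move=> u _; exact: continuous_bform.
(* The ambient norm is the maximum norm, and each squared coordinate is at most the squared
   Euclidean norm. *)
have S_bounded : bounded_set S.
  exists 1; split=> // M M_gt1 u; rewrite /S/= bform_sum mulmx1 => u1.
  apply/(le_trans _ (ltW M_gt1)); rewrite [X in X <= _]mx_normrE.
  apply: bigmax_le => // -[i j] _ /=; rewrite ord1 -(@expr_le1 _ 2)// real_normK ?num_real//.
  rewrite -u1 (bigD1 j)//= -expr2 lerDl; apply: sumr_ge0 => k _.
  by rewrite -expr2 sqr_ge0.
have S_neq0 : (S !=set0)%classic.
  pose i0 := Ordinal n_gt0; exists (delta_mx 0 i0).
  rewrite /S/= bform_sum mulmx1 (bigD1 i0)//= big1 => [|i ii0]; rewrite !mxE ?eqxx.
    by rewrite mulr1 addr0.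
  by rewrite (negPf ii0) mulr0.
have [v] := @EVT_min_rV _ _ _ _ S_neq0 (bounded_closed_compact S_bounded S_closed)
  (continuous_subspaceT (continuous_bform A)).
rewrite inE /S/= => v1 v_min.
pose mu := bform A v v.
have mu_le u : mu * bform 1%:M u u <= bform A u u.
  have [->|u_neq0] := eqVneq u 0; first by rewrite /bform !mul0mx !mxE mulr0.
  have u_gt0 : 0 < bform 1%:M u u by rewrite lt_def bform1_eq0 u_neq0 bform1_ge0.
  set a := Num.sqrt (bform 1%:M u u).
  have a_gt0 : 0 < a by rewrite sqrtr_gt0.
  have aa : a * a = bform 1%:M u u by rewrite -expr2 sqr_sqrtr// ltW.
  have /v_min : a^-1 *: u \in S.
    by rewrite inE /S/= bformZl bformZr -aa; field; rewrite gt_eqF.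
  rewrite bformZl bformZr mulrA -invfM aa mulrC => h.
  by rewrite -ler_pdivlMr.
exists v, mu; split=> //.
  by rewrite -bform1_eq0 v1 oner_eq0.
have : v *m (A + (- mu) *: 1%:M) = 0.
  apply: psd_isotropic_ker.
  - by rewrite linearD linearZ/= As tr_scalar_mx.
  - by move=> u; rewrite bform_addmx bform_scalemx mulNr subr_ge0.
  - by rewrite bform_addmx bform_scalemx v1 mulr1 subrr.
by rewrite mulmxDr -scalemxAr mulmx1 scaleNr => /eqP; rewrite subr_eq0 => /eqP.
Qed.

Lemma eigenvalue_ge_rayleigh {R : realType} {n} (A : 'M[R]_n) mu l :
  (forall u, mu * bform 1%:M u u <= bform A u u) -> eigenvalue A l -> mu <= l.
Proof.
move=> mu_le /eigenvalueP[w wA w_neq0].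
have w_gt0 : 0 < bform 1%:M w w by rewrite lt_def bform1_eq0 w_neq0 bform1_ge0.
by have := mu_le w; rewrite (bform_eigenvector _ _ _ wA) ler_pM2r.
Qed.

(** The Rayleigh minimum is itself an eigenvalue and bounds all others from below, so it is the
    infimum. *)
Lemma lambda_minP {R : realType} {n} (A : 'M[R]_n) : (0 < n)%N -> A^T = A ->
  exists2 v : 'rV[R]_n, v != 0 & v *m A = lambda_min A *: v /\
    forall u, lambda_min A * bform 1%:M u u <= bform A u u.
Proof.
move=> n_gt0 As; have [v [mu [v_neq0 vA mu_le]]] := rayleigh_min A n_gt0 As.
suff -> : lambda_min A = mu by exists v.
have mu_lb : lbound [set l | eigenvalue A l]%classic mu.
  by move=> l; exact: eigenvalue_ge_rayleigh.
have mu_in : [set l | eigenvalue A l]%classic mu by apply/eigenvalueP; exists v.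
apply/eqP; rewrite eq_le ge_inf//; last by exists mu.
by rewrite lb_le_inf//; exists mu.
Qed.

Lemma bform_le_lambda_max {R : realType} {n} (A : 'M[R]_n) u :
  (0 < n)%N -> A^T = A -> bform A u u <= lambda_max A * bform 1%:M u u.
Proof.
move=> n_gt0 As.
have bformN w : bform (- A) w w = - bform A w w.
  by rewrite -scaleN1r bform_scalemx mulN1r.
have NAs : (- A)^T = - A by rewrite linearN/= As.
have [v [mu [v_neq0 vA mu_le]]] := rayleigh_min (- A) n_gt0 NAs.
have mu_in : [set l | eigenvalue A l]%classic (- mu).
  by apply/eigenvalueP; exists v => //; rewrite scaleNr -vA mulmxN opprK.
(* Boundedness matters: [sup] of an unbounded set is only a default value. *)
have mu_ub : has_ubound [set l | eigenvalue A l]%classic.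
  exists (- mu) => l /= /eigenvalueP[w wA w_neq0]; rewrite lerNr.
  apply: (eigenvalue_ge_rayleigh _ _ _ mu_le); apply/eigenvalueP; exists w => //.
  by rewrite mulmxN wA scaleNr.
apply: (@le_trans _ _ (- mu * bform 1%:M u u)).
  by rewrite mulNr lerNr -bformN.
by rewrite ler_wpM2r ?bform1_ge0// (ub_le_sup mu_ub).
Qed.

(** At a basis vector the form is a diagonal entry, here zero. *)
Lemma lambda_min_le0 {R : realType} {n} (A : 'M[R]_n) :
  (0 < n)%N -> A^T = A -> zero_diagonal A -> lambda_min A <= 0.
Proof.
move=> n_gt0 As A_diag; have [v _ [_ /(_ (delta_mx 0 (Ordinal n_gt0)))]] := lambda_minP A n_gt0 As.
set i0 := Ordinal _.
have delta_bform (B : 'M[R]_n) : bform B (delta_mx 0 i0) (delta_mx 0 i0) = B i0 i0.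
  by rewrite /bform -rowE trmx_delta -colE !mxE.
by rewrite !delta_bform A_diag mxE eqxx mulr1.
Qed.

(** * Exponential benefit functions *)

(** The marginal benefit [expR (q - t)] equals the unit cost 1 exactly at [t = q], so any vector [q]
    can be prescribed. *)
Definition exp_benefit {R : realType} (q t : R) : R := - expR (q - t).

Lemma is_derive_expR_sub {R : realType} (q t : R) :
  is_derive t 1 (fun s => expR (q - s)) (- expR (q - t)).
Proof.
have -> : - expR (q - t) = expR (q - t) * (0 - 1) by rewrite sub0r mulrN1.
have dsub : is_derive t (1 : R) (fun s : R => q - s) (0 - 1) by exact: is_deriveB.
exact: (@is_derive1_comp R expR (fun s => q - s)).
Qed.

Lemma is_derive_exp_benefit {R : realType} (q t : R) :
  is_derive t 1 (exp_benefit q) (expR (q - t)).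
Proof.
rewrite -[X in is_derive _ _ _ X]opprK.
by have := is_derive_expR_sub q t; exact: is_deriveN.
Qed.

Lemma derive1_exp_benefit {R : realType} (q : R) :
  derive1 (exp_benefit q) = fun t => expR (q - t).
Proof.
apply/funext => t; rewrite derive1E.
by have [] := is_derive_exp_benefit q t.
Qed.

Lemma exp_benefitP {R : realType} (q : R) : benefit_function (exp_benefit q).
Proof.
split.
- split=> t; first by have [] := is_derive_exp_benefit q t.
  by rewrite derive1_exp_benefit; have [] := is_derive_expR_sub q t.
- by move=> s t st; rewrite ltrN2 ltr_expR ltrD2l ltrN2.
- move=> s t p st /andP[p_gt0 p_lt1]; rewrite /exp_benefit.
  set m := p * s + (1 - p) * t.
  (* The graph of the exponential lies strictly above its tangent at [m], away from [m]. Averaging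
     the bounds at [s] and [t] cancels the linear terms, as [m] is their mean. *)
  have tangent r : r != m -> expR (q - m) * (1 + (m - r)) < expR (q - r).
    move=> rm; rewrite (_ : q - r = (q - m) + (m - r)); last by ring.
    rewrite (expRD (q - m)) ltr_pM2l ?expR_gt0//.
    by rewrite expR_gt1Dx// subr_eq0 eq_sym.
  have s_neq_m : s != m.
    apply: contra_neq st => sm; apply/eqP; rewrite -subr_eq0.
    have : (1 - p) * (s - t) = 0 by rewrite -(subrr m) -{1}sm /m; ring.
    by move/eqP; rewrite mulf_eq0 gt_eqF ?subr_gt0.
  have t_neq_m : t != m.
    apply: contra_neq st => tm; apply/eqP; rewrite -subr_eq0.
    have : p * (s - t) = 0 by rewrite -(subrr m) -{2}tm /m; ring.
    by move/eqP; rewrite mulf_eq0 gt_eqF.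
  have p1_gt0 : 0 < 1 - p by rewrite subr_gt0.
  have hs := tangent s s_neq_m; have ht := tangent t t_neq_m.
  rewrite -(ltr_pM2l p_gt0) in hs; rewrite -(ltr_pM2l p1_gt0) in ht.
  have e : p * (expR (q - m) * (1 + (m - s))) +
      (1 - p) * (expR (q - m) * (1 + (m - t))) = expR (q - m) by rewrite /m; ring.
  by rewrite !mulrN -opprD ltrN2 -e ltrD.
Qed.

Lemma exp_benefit_admissible {R : realType} {N : nat} (q : 'I_N -> R) :
  admissible_benefits_costs (fun i => exp_benefit (q i)) (fun=> 1).
Proof.
move=> i; split; [exact: exp_benefitP|exact: ltr01|].
by exists (q i); rewrite derive1_exp_benefit subrr expR0.
Qed.

(** * Equilibria from complementarity *)

(** Zero diagonals keep the aggregate of the neighbours fixed when agent [i] deviates. *)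
Lemma utility_deviate {R : realType} {N : nat} (G1 G2 : 'M[R]_N) kappa b c
    (x : 'cV[R]_N) i y : zero_diagonal G1 -> zero_diagonal G2 ->
  utility G1 G2 kappa b c i (deviate x i y) =
  b i (y + ((kappa *: G1 + (1 - kappa) *: G2) *m x) i 0) - c i * y.
Proof.
move=> G1_diag G2_diag; rewrite /utility.
have sum_deviate (G : 'M[R]_N) : zero_diagonal G ->
    \sum_j G i j * deviate x i y j 0 = (G *m x) i 0.
  move=> G_diag; rewrite mxE; apply: eq_bigr => j _; rewrite mxE.
  by have [->|//] := eqVneq j i; rewrite G_diag !mul0r.
rewrite !sum_deviate// [deviate x i y i 0]mxE eqxx.
by rewrite mulmxDl -!scalemxAl !mxE addrA.
Qed.

Lemma deviate_id {R : realType} {N : nat} (x : 'cV[R]_N) i : deviate x i (x i 0) = x.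
Proof. by apply/colP => j; rewrite mxE; case: eqP => [->|]. Qed.

(** Utility is concave in own effort, so first-order conditions suffice: marginal benefit at most 1,
    with equality unless the effort is zero. *)
Lemma complementary_nash {R : realType} {N : nat} (G1 G2 : 'M[R]_N) kappa
    (q x : 'cV[R]_N) :
  zero_diagonal G1 -> zero_diagonal G2 ->
  (forall i, let w := ((1%:M + (kappa *: G1 + (1 - kappa) *: G2)) *m x - q) i 0 in
     [/\ 0 <= x i 0, 0 <= w & w * x i 0 = 0]) ->
  nash_equilibrium G1 G2 kappa (fun i => exp_benefit (q i 0)) (fun=> 1) x.
Proof.
move=> G1_diag G2_diag x_comp; split=> [i|i y y_ge0]; first by have [] := x_comp i.
rewrite -{2}(deviate_id x i) !utility_deviate//= !mul1r /exp_benefit.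
have /= := x_comp i; rewrite mulmxDl mul1mx; set Gx := _ *m x.
rewrite (_ : (x + Gx - q) i 0 = x i 0 + Gx i 0 - q i 0); last by rewrite !mxE.
move: (x i 0) (Gx i 0) => a s [a_ge0]; rewrite subr_ge0 => q_le /eqP compl.
(* Here [e] is the marginal benefit at [a]. Deviating multiplies it by [expR (a - y)], which is at
   least [1 + (a - y)]; the claim reduces to the first-order inequality [(a - y) * (1 - e) <= 0]. *)
rewrite (_ : q i 0 - (y + s) = (q i 0 - (a + s)) + (a - y)); last by ring.
rewrite expRD; set e := expR (q i 0 - (a + s)).
have e_gt0 : 0 < e by exact: expR_gt0.
suff : (a - y) * (1 - e) <= 0.
  have := expR_ge1Dx (a - y); rewrite -(ler_pM2l e_gt0); lra.
move: compl; rewrite mulf_eq0 subr_eq0 => /orP[/eqP aq|/eqP ->].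
  by rewrite /e aq subrr expR0 subrr mulr0.
rewrite mulr_le0_ge0 ?sub0r ?oppr_le0// subr_ge0 /e -expR0 ler_expR.
by rewrite subr_le0.
Qed.

Theorem proposition4 (R : realType) (N : nat) (G1 G2 : 'M[R]_N) (kappa : R)
    (N_gt0 : (0 < N)%N)
    (G1_sym : G1^T = G1) (G2_sym : G2^T = G2)
    (G1_diag : zero_diagonal G1) (G2_diag : zero_diagonal G2)
    (kappa_range : 0 <= kappa < 1)
    (lambda_bound :
       1 / (1 - kappa) * (1 + kappa * lambda_max G1) <= `|lambda_min G2|) :
  exists (b : 'I_N -> R -> R) (c : 'I_N -> R),
    admissible_benefits_costs b c /\
    ((forall x : 'cV[R]_N, ~ nash_equilibrium G1 G2 kappa b c x) \/
     (exists x y : 'cV[R]_N,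
        [/\ x <> y, nash_equilibrium G1 G2 kappa b c x
          & nash_equilibrium G1 G2 kappa b c y])).
Proof.
have /andP[kappa_ge0 kappa_lt1] := kappa_range.
pose M : 'M[R]_N := 1%:M + (kappa *: G1 + (1 - kappa) *: G2).
have M_sym : M^T = M by rewrite !linearD !linearZ/= G1_sym G2_sym tr_scalar_mx.
have [u u_neq0 [uG2 _]] := lambda_minP G2 N_gt0 G2_sym.
(* The form at [u] is at most [1 + kappa * lambda_max G1 + (1 - kappa) * lambda_min G2] times the
   squared norm of [u], and the assumed bound makes this factor nonpositive. *)
have uMu_le0 : bform M u u <= 0.
  rewrite !bform_addmx !bform_scalemx (bform_eigenvector _ _ _ uG2).
  have G1u := bform_le_lambda_max G1 u N_gt0 G1_sym.
  move: lambda_bound; rewrite ler0_norm ?lambda_min_le0//.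
  rewrite mul1r mulrC ler_pdivrMr ?subr_gt0// => bound.
  have := ler_wpM2l kappa_ge0 G1u.
  have := ler_wpM2r (bform1_ge0 u) bound; lra.
have [v v_neq0 v_rev] := sign_reversed_vector M u M_sym u_neq0 uMu_le0.
pose pos (z : 'cV[R]_N) : 'cV[R]_N := \col_i Num.max 0 (z i 0).
pose z := v^T; pose w := M *m z.
(* Since [pos (- t)] is the negative part, this is the splitting of [t] into its two parts. Applied
   to [z] and [w = M *m z], it gives the second expression for [q]. *)
have posE t : pos t = t + pos (- t).
  by apply/colP => i; rewrite !mxE; case: (leP 0 (t i 0)); case: (leP 0 (- t i 0)); lra.
pose q := M *m pos z - pos w.
have qN : q = M *m pos (- z) - pos (- w).
  by rewrite /q [pos z]posE [pos w]posE mulmxDr -/w opprD addrACA subrr add0r.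
have wz i : w i 0 * z i 0 <= 0.
  by rewrite -[w]trmxK trmx_mul trmxK M_sym mxE [z i 0]mxE.
(* The slack [M *m pos s - q] is [pos t]. It is complementary to [pos s] because [t] and [s] are
   never both positive at an index. *)
have nash_pos s t : q = M *m pos s - pos t -> (forall i, t i 0 * s i 0 <= 0) ->
    nash_equilibrium G1 G2 kappa (fun i => exp_benefit (q i 0)) (fun=> 1) (pos s).
  move=> qE ts; apply: complementary_nash => // i /=.
  rewrite -/M qE opprB addrC subrK !mxE; split; rewrite ?le_max ?lexx//.
  have := ts i; case: (leP 0 (t i 0)) => [t_ge0|_]; last by rewrite mul0r.
  case: (leP 0 (s i 0)) => [s_ge0|_]; last by rewrite mulr0.
  by move=> ts_le0; apply/eqP; rewrite eq_le ts_le0 mulr_ge0.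
exists (fun i => exp_benefit (q i 0)), (fun=> 1); split.
  exact: exp_benefit_admissible.
right; exists (pos z), (pos (- z)); split.
(* The two equilibria differ by [z], the transpose of the nonzero [v]. *)
- move/eqP; rewrite posE -subr_eq0 addrK trmx_eq0; exact/negP.
- exact: nash_pos wz.
- apply: (nash_pos _ _ qN) => i; have := wz i; rewrite -mulrNN.
  by congr (_ * _ <= 0); rewrite [RHS]mxE.
Qed.
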